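(* Let $F\subset\mathbb{R}^d$ be a compact convex set with $0\in\operatorname{int}(F)$, and let $m\ge2$, $1\le k\le m$. Let $\hat\Omega\in\mathcal{K}^m$ and let $U_0$ be a neighborhood of $\hat\Omega$ in $(\mathcal{K}^m,d_{\mathcal{K}^m})$. Suppose that there exists a compact set $W\subset\mathbb{R}^{dk}$ such that $S_k(\Omega)\subset W$ for all $\Omega\in U_0$. Then the global solution mapping $S_k$ is upper semicontinuous at $\hat\Omega$.
   Context: $\mathbb{R}^d$ ($d\ge1$) and $\mathbb{R}^{dk}=(\mathbb{R}^d)^k$ carry their Euclidean norms. The minimal time function is $T_F(x,\Omega)=\inf\{t\ge 0\mid (x+tF)\cap\Omega\neq\emptyset\}$ for $x\in\mathbb{R}^d$ and nonempty $\Omega\subset\mathbb{R}^d$. $\mathcal{K}$ is the family of nonempty compact subsets of $\mathbb{R}^d$ with the Hausdorff metric $d_{\mathcal{K}}(A,B)=\max\{\sup_{a\in A}\inf_{b\in B}\|a-b\|,\ \sup_{b\in B}\inf_{a\in A}\|a-b\|\}$; on $\mathcal{K}^m$, $d_{\mathcal{K}^m}(\Omega,\hat\Omega)=\max_{1\le i\le m}d_{\mathcal{K}}(\Omega^i,\hat\Omega^i)$ for $\Omega=(\Omega^1,\dots,\Omega^m)$, $\hat\Omega=(\hat\Omega^1,\dots,\hat\Omega^m)$. For $x=(x^1,\dots,x^k)\in\mathbb{R}^{dk}$, $f_k(x,\Omega)=\sum_{i=1}^m\min_{1\le j\le k}T_F(x^j,\Omega^i)$, $v_k(\Omega)=\min_{x\in\mathbb{R}^{dk}}f_k(x,\Omega)$,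 and $S_k(\Omega)=\{x\in\mathbb{R}^{dk}\mid f_k(x,\Omega)=v_k(\Omega)\}$. A set-valued mapping $G:\mathcal{K}^m\rightrightarrows\mathbb{R}^{dk}$ is upper semicontinuous at $\hat\Omega$ (with $G(\hat\Omega)\neq\emptyset$) if for every open $V\subset\mathbb{R}^{dk}$ with $G(\hat\Omega)\subset V$ there is a neighborhood $U$ of $\hat\Omega$ such that $G(\Omega)\subset V$ for all $\Omega\in U$. *)

(* Defs.v *)
From HB Require Import structures.
From mathcomp Require Import all_boot all_order all_algebra.
From mathcomp Require Import all_classical all_reals all_analysis.
Import Order.TTheory GRing.Theory Num.Theory numFieldNormedType.Exports.

Set Implicit Arguments.
Unset Strict Implicit.
Unset Printing Implicit Defensive.

Local Open Scope classical_set_scope.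
Local Open Scope ring_scope.

(* The norm that the library puts on matrices is the sup norm, so the Euclidean
   norm, which enters the Hausdorff distance, is defined here.  Compactness,
   openness and interior refer to the library topology of ['rV[R]_d] and
   ['M[R]_(k, d)], which is the Euclidean one since all norms on a
   finite-dimensional space are equivalent. *)
Definition enorm (R : realType) (d : nat) (x : 'rV[R]_d) : R :=
  Num.sqrt (\sum_(i < d) x 0 i ^+ 2).

(* [inf] is real-valued and takes the junk value [0] when no [t] is admissible;
   this cannot happen if [0] is interior to [F] and [A] is nonempty. *)
Definition min_time (R : realType) (d : nat) (F : set 'rV[R]_d)
    (x : 'rV[R]_d) (A : set 'rV[R]_d) : R :=
  inf [set t : R | 0 <= t /\ ([set x + t *: y | y in F] `&` A) !=set0].

Record compacts (R : realType) (d : nat) := Compacts {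
  compacts_set :> set 'rV[R]_d;
  compacts_nonempty : compacts_set !=set0;
  compacts_compact : compact compacts_set
}.

Definition hausdorff_excess (R : realType) (d : nat) (A B : set 'rV[R]_d) : R :=
  sup [set inf [set enorm (a - b) | b in B] | a in A].

Definition hausdorff_dist (R : realType) (d : nat) (A B : compacts R d) : R :=
  Num.max (hausdorff_excess A B) (hausdorff_excess B A).

(* The default value [0] of the iterated maximum is harmless, distances being
   nonnegative. *)
Definition hausdorff_dist_tuple (R : realType) (d m : nat)
    (O O' : 'I_m -> compacts R d) : R :=
  \big[Num.max/0]_(i < m) hausdorff_dist (O i) (O' i).

Definition hausdorff_nbhs (R : realType) (d m : nat)
    (O : 'I_m -> compacts R d) (U : set ('I_m -> compacts R d)) : Prop :=
  exists2 e : R, 0 < e & forall O', hausdorff_dist_tuple O O' < e -> U O'.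

(* A point [x = (x^1, ..., x^k)] of [(R^d)^k] is the matrix whose [j]-th row is
   [x^j].  For [k >= 1] the inner infimum, over a finite nonempty set, is the
   minimum over [j]. *)
Definition f_k (R : realType) (d m k : nat) (F : set 'rV[R]_d)
    (x : 'M[R]_(k, d)) (O : 'I_m -> compacts R d) : R :=
  \sum_(i < m) inf (range (fun j : 'I_k => min_time F (row j x) (O i))).

(* The minimum over [x] is written as an infimum; it is attained exactly when
   [S_k], the set of points realizing it, is nonempty. *)
Definition v_k (R : realType) (d m k : nat) (F : set 'rV[R]_d)
    (O : 'I_m -> compacts R d) : R :=
  inf (range (fun x : 'M[R]_(k, d) => f_k F x O)).

Definition S_k (R : realType) (d m k : nat) (F : set 'rV[R]_d)
    (O : 'I_m -> compacts R d) : set 'M[R]_(k, d) :=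
  [set x | f_k F x O = v_k k F O].

(* Nonemptiness of the value at the reference point is part of the notion. *)
Definition upper_semicontinuous_at (R : realType) (d m k : nat)
    (G : ('I_m -> compacts R d) -> set 'M[R]_(k, d))
    (O : 'I_m -> compacts R d) : Prop :=
  G O !=set0 /\
  forall V : set 'M[R]_(k, d), open V -> G O `<=` V ->
    exists2 U, hausdorff_nbhs O U & forall O', U O' -> G O' `<=` V.

(* Main.v *)
Require Import Defs.
From HB Require Import structures.
From mathcomp Require Import all_boot all_order all_algebra.
From mathcomp Require Import all_classical all_reals all_analysis.
From mathcomp Require Import lra.
Import Order.TTheory GRing.Theory Num.Theory numFieldNormedType.Exports.
Local Open Scope classical_set_scope.
Local Open Scope ring_scope.

(* Since [F] contains a ball of radius [r] around [0], any displacement of length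
   [s] can be made in extra time [s / r]; hence [f_k] and [v_k] are Lipschitz,
   jointly in the centres and in the sites.  Centres outside a large ball serve
   no site in a near-optimal configuration and may be moved to [0], so the
   minimum over a compact ball is a global one and [S_k Ohat] is nonempty.  If
   [V] contains [S_k Ohat], then [f_k _ Ohat] exceeds the optimal value by a
   uniform gap on the compact set [W] minus [V]; sites so close to [Ohat] that
   [f_k] and [v_k] change by less than half of this gap have no solution there. *)

(** * Sup norm, Euclidean norm, and consequences of compactness *)

Lemma mx_norm_le {R : realType} {m n : nat} (A : 'M[R]_(m, n)) (M : R) :
  0 <= M -> (`|A| <= M) <-> (forall i j, `|A i j| <= M).
Proof.
move=> M0; rewrite [X in X <= _]/Num.norm/= mx_normrE; split=> [/bigmax_leP[_ AM] i j|AM].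
  exact: (AM (i, j)).
by apply/bigmax_leP; split=> // -[i j] _; exact: AM.
Qed.

Lemma entry_le_mx_norm {R : realType} {m n : nat} (A : 'M[R]_(m, n)) i j :
  `|A i j| <= `|A|.
Proof. exact: (mx_norm_le A _ (normr_ge0 _)).1. Qed.

Lemma row_norm_le {R : realType} {m n : nat} (A : 'M[R]_(m, n)) i :
  `|row i A| <= `|A|.
Proof. by apply/mx_norm_le => // ? j; rewrite mxE entry_le_mx_norm. Qed.

Lemma vec_mx_norm_le {R : realType} {m n : nat} (v : 'rV[R]_(m * n)) :
  `|vec_mx v| <= `|v|.
Proof. by apply/mx_norm_le => // i j; rewrite mxE entry_le_mx_norm. Qed.

Lemma mxvec_norm_le {R : realType} {m n : nat} (A : 'M[R]_(m, n)) :
  `|mxvec A| <= `|A|.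
Proof.
apply/mx_norm_le => // i j; case/mxvec_indexP: j => k l.
by rewrite ord1 mxvecE entry_le_mx_norm.
Qed.

Lemma norm_le_enorm {R : realType} {d : nat} (x : 'rV[R]_d) : `|x| <= enorm x.
Proof.
apply/mx_norm_le => [|i j]; first exact: sqrtr_ge0.
rewrite ord1 /enorm -sqrtr_sqr ler_wsqrtr// (bigD1 j)//= lerDl sumr_ge0// => ? _.
exact: sqr_ge0.
Qed.

Lemma enorm_le {R : realType} {d : nat} (x : 'rV[R]_d) (M : R) :
  `|x| <= M -> enorm x <= Num.sqrt (\sum_(i < d) M ^+ 2).
Proof.
move=> xM; apply/ler_wsqrtr/ler_sum => i _.
rewrite -(real_normK (num_real (x 0 i))) lerXn2r ?nnegrE//.
  exact: le_trans xM.
exact: le_trans (entry_le_mx_norm _ _ _) xM.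
Qed.

Lemma lipschitz_continuous {R : realType} {V : normedModType R}
    (f : V -> R) (c : R) :
  (forall x y, f x <= f y + c * `|x - y|) -> continuous f.
Proof.
move=> lip x; apply/cvgrPdist_le => e e0.
near=> y.
(* The sign of [c] is unknown; [|c| + 1] is a positive upper bound by which [e] can be divided. *)
have c1 : c <= `|c| + 1 by rewrite ler_wpDr// ler_norm.
have cp : 0 < `|c| + 1 by rewrite ltr_wpDl.
have ce : c * `|x - y| <= e.
  rewrite (le_trans (ler_wpM2r (normr_ge0 _) c1))//.
  rewrite mulrC -ler_pdivlMr// ltW//.
  near: y; apply: cvgr_dist_lt => //; exact: divr_gt0.
have yx := lip y x; have xy := lip x y; rewrite distrC in yx.
by rewrite ler_distl; apply/andP; split; lra.
Unshelve. all: by end_near. Qed.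

Lemma compact_norm_bound {R : realType} {V : normedModType R} (A : set V) :
  compact A -> exists2 M : R, 0 < M & forall x, A x -> `|x| <= M.
Proof. by move=> /compact_bounded/pinfty_ex_gt0[M M0 AM]; exists M. Qed.

Lemma interior_norm_ball {R : realType} {V : normedModType R} (F : set V) :
  interior F 0 -> exists2 r : R, 0 < r & forall z, `|z| <= r -> F z.
Proof.
move=> /nbhs_closedballP[r rF]; exists r%:num => // z zr.
by apply: rF; rewrite closed_ballE//= /closed_ball_/= sub0r normrN.
Qed.

(** * From Hausdorff distance to nearby points *)

(** The strict bound passes to the infimum of the distances from [a], so some [b] realizes it. The
    Euclidean norm dominates the sup norm, and all later estimates use the latter. *)
Lemma hausdorff_dist_close {R : realType} {d : nat} (A B : compacts R d) (e : R) :
  hausdorff_dist A B < e -> forall a, compacts_set A a -> exists2 b, compacts_set B b & `|b - a| <= e.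
Proof.
rewrite /hausdorff_dist gt_max => /andP[ABe _] a Aa.
have [M M0 AM] := compact_norm_bound A (@compacts_compact _ _ A).
have [b0 Bb0] := @compacts_nonempty _ _ B.
have lb c : has_lbound [set enorm (c - b) | b in B].
  by exists 0 => _ [b _ <-]; exact: sqrtr_ge0.
(* A [sup] bounds its set only if that set is bounded above; here the distances to one point [b0]
   suffice, as [A] is bounded. *)
have ub : has_ubound [set inf [set enorm (a - b) | b in B] | a in A].
  exists (Num.sqrt (\sum_(i < d) (M + `|b0|) ^+ 2)) => _ [c Ac <-].
  apply: (@le_trans _ _ (enorm (c - b0))); first by apply: ge_inf => //; exists b0.
  by apply: enorm_le; rewrite (le_trans (ler_normB _ _))// lerD2r AM.
have : inf [set enorm (a - b) | b in B] < e.
  by apply: le_lt_trans ABe; apply: ub_le_sup => //; exists a.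
move=> /inf_lt[|_ [b Bb <-] abe]; first by exists (enorm (a - b0)), b0.
by exists b => //; rewrite distrC (le_trans (norm_le_enorm _))// ltW.
Qed.

Lemma hausdorff_distC {R : realType} {d : nat} (A B : compacts R d) :
  hausdorff_dist A B = hausdorff_dist B A.
Proof. exact: maxC. Qed.

Lemma hausdorff_dist_tupleC {R : realType} {d m : nat}
    (O O' : 'I_m -> compacts R d) :
  hausdorff_dist_tuple O O' = hausdorff_dist_tuple O' O.
Proof. by apply: eq_bigr => i _; exact: hausdorff_distC. Qed.

Lemma hausdorff_dist_tuple_close {R : realType} {d m : nat}
    (O O' : 'I_m -> compacts R d) (e : R) :
  hausdorff_dist_tuple O O' < e ->
  forall i a, compacts_set (O i) a -> exists2 b, compacts_set (O' i) b & `|b - a| <= e.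
Proof.
move=> OO'e i; apply: hausdorff_dist_close; apply: le_lt_trans OO'e.
exact: (le_bigmax 0 (fun i => hausdorff_dist (O i) (O' i))).
Qed.

(** * The minimal time function *)

(* By convexity, [t *: F + u *: F] is contained in [(t + u) *: F]. *)
Lemma convex_displacement {R : realType} {d : nat} (F : set 'rV[R]_d) (r t u : R)
    (y p : 'rV[R]_d) :
  convex_set F -> 0 < r -> (forall z, `|z| <= r -> F z) -> F y ->
  0 <= t -> 0 <= u -> `|p| <= u * r ->
  exists2 y', F y' & (t + u) *: y' = t *: y + p.
Proof.
move=> cF r0 Fr Fy t0 u0 pur.
have [tu0|tu0] := eqVneq (t + u) 0.
  have t00 : t = 0 by lra.
  have u00 : u = 0 by lra.
  exists y => //; rewrite tu0 t00 !scale0r add0r.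
  by move: pur; rewrite u00 mul0r normr_le0 => /eqP ->.
have tup : 0 < t + u by rewrite lt_def tu0 addr_ge0.
(* For [u = 0] the inverse is [0] by convention, but then [p = 0] as well. *)
have upE : u *: (u^-1 *: p) = p.
  have [u00|un0] := eqVneq u 0; last by rewrite scalerA divff// scale1r.
  by move: pur; rewrite u00 mul0r normr_le0 scale0r => /eqP ->.
have Fw : F (u^-1 *: p).
  apply: Fr; rewrite normrZ normfV (ger0_norm u0).
  have [->|un0] := eqVneq u 0; first by rewrite invr0 mul0r ltW.
  by rewrite mulrC ler_pdivrMr 1?mulrC// lt_def un0.
have l0 : 0 <= t / (t + u) by rewrite divr_ge0// ltW.
have l1 : t / (t + u) <= 1 by rewrite ler_pdivrMr// mul1r lerDl.
(* The witness is the mean of [y] and [u^-1 *: p] with weights [t / (t + u)] and [u / (t + u)]. *)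
have := cF y (u^-1 *: p) (Itv01 l0 l1) (mem_set Fy) (mem_set Fw).
rewrite inE => Fc; exists (t / (t + u) *: y + (1 - t / (t + u)) *: (u^-1 *: p)); first exact: Fc.
rewrite scalerDr !scalerA.
have -> : (t + u) * (t / (t + u)) = t by rewrite mulrC divfK.
have -> : (t + u) * (1 - t / (t + u)) = u.
  by rewrite mulrBr mulr1 [_ * (t / _)]mulrC divfK// addrAC subrr add0r.
by rewrite -scalerA upE.
Qed.

(** Starting at time [0], the displacement [a - x] takes time [|a - x| / r]. So [min_time] never
    takes the default value of [inf] on an empty set. *)
Lemma min_time_reachable {R : realType} {d : nat} (F : set 'rV[R]_d) (r : R)
    (x : 'rV[R]_d) (A : set 'rV[R]_d) :
  convex_set F -> 0 < r -> (forall z, `|z| <= r -> F z) -> A !=set0 ->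
  [set t : R | 0 <= t /\ ([set x + t *: y | y in F] `&` A) !=set0] !=set0.
Proof.
move=> cF r0 Fr [a Aa].
have u0 : 0 <= `|a - x| / r by rewrite divr_ge0// ltW.
have [|||y Fy] := @convex_displacement R d F r 0 (`|a - x| / r) 0 (a - x) cF r0 Fr _ _ u0.
- by apply: Fr; rewrite normr0 ltW.
- exact: lexx.
- by rewrite divfK ?gt_eqF.
rewrite scaler0 !add0r => yE.
exists (`|a - x| / r); split=> //; exists a; split=> //.
by exists y => //; rewrite yE addrC subrK.
Qed.

Lemma min_time_ge0 {R : realType} {d : nat} (F : set 'rV[R]_d) (r : R)
    (x : 'rV[R]_d) (A : set 'rV[R]_d) :
  convex_set F -> 0 < r -> (forall z, `|z| <= r -> F z) -> A !=set0 ->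
  0 <= min_time F x A.
Proof.
move=> cF r0 Fr A0; apply: lb_le_inf; first exact: (min_time_reachable F r).
by move=> t [].
Qed.

(** A path from [x] that hits [a] at time [t] is corrected by [(x - x') + (b - a)], so that it leads
    from [x'] to [b]; [convex_displacement] prices this correction. *)
Lemma min_time_lipschitz {R : realType} {d : nat} (F : set 'rV[R]_d) (r s : R)
    (x x' : 'rV[R]_d) (A B : set 'rV[R]_d) :
  convex_set F -> 0 < r -> (forall z, `|z| <= r -> F z) -> A !=set0 ->
  (forall a, A a -> exists2 b, B b & `|b - a| <= s) ->
  min_time F x' B <= min_time F x A + (`|x - x'| + s) / r.
Proof.
move=> cF r0 Fr A0 AB.
rewrite -lerBlDr; apply: lb_le_inf; first exact: (min_time_reachable F r).
move=> t [t0 [_ [[y Fy <-] /AB[b Bb bs]]]].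
have u0 : 0 <= (`|x - x'| + s) / r.
  by rewrite divr_ge0 ?(ltW r0)// addr_ge0// (le_trans _ bs).
have [||y' Fy' y'E] := @convex_displacement R d F r t ((`|x - x'| + s) / r) y
    (x - x' + (b - (x + t *: y))) cF r0 Fr Fy _ u0 => //.
  by rewrite divfK ?gt_eqF// (le_trans (ler_normD _ _))// lerD2l.
rewrite lerBlDr; apply: ge_inf; first by exists 0 => ? [].
split; first exact: addr_ge0.
exists b; split=> //; exists y' => //; rewrite y'E.
by apply/rowP => i; rewrite !mxE; lra.
Qed.

(** Some [a] in [A] equals [x + t *: y] with [t < L] and [y] in [F], so [x] is within [L * MF] of
    [A]. *)
Lemma min_time_coercive {R : realType} {d : nat} (F : set 'rV[R]_d)
    (r MF MA L : R) (x : 'rV[R]_d) (A : set 'rV[R]_d) :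
  convex_set F -> 0 < r -> (forall z, `|z| <= r -> F z) -> A !=set0 ->
  (forall y, F y -> `|y| <= MF) -> (forall a, A a -> `|a| <= MA) ->
  min_time F x A < L -> `|x| <= MA + L * MF.
Proof.
move=> cF r0 Fr A0 FM AM /inf_lt[|t [t0 [a [[y Fy xya] Aa]]] tL].
  exact: (min_time_reachable F r).
have -> : x = a - t *: y by rewrite -xya addrK.
rewrite (le_trans (ler_normB _ _))// lerD ?AM// normrZ (ger0_norm t0).
by rewrite ler_pM ?FM// ltW.
Qed.

(** * Lipschitz estimates for the objective and the optimal value *)

Lemma inf_range_le {R : realType} {T : Type} (g : T -> R) (t : T) :
  (forall t, 0 <= g t) -> inf (range g) <= g t.
Proof. by move=> g0; apply: ge_inf; [exists 0 => _ [? _ <-]|exists t]. Qed.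

Lemma le_inf_range {R : realType} {T : Type} (g : T -> R) (c : R) (t0 : T) :
  (forall t, c <= g t) -> c <= inf (range g).
Proof. by move=> cg; apply: lb_le_inf; [exists (g t0), t0|move=> _ [? _ <-]]. Qed.

Lemma f_k_ge0 {R : realType} {d m k : nat} (F : set 'rV[R]_d) (r : R)
    (x : 'M[R]_(k, d)) (O : 'I_m -> compacts R d) :
  convex_set F -> 0 < r -> (forall z, `|z| <= r -> F z) -> (0 < k)%N ->
  0 <= f_k F x O.
Proof.
move=> cF r0 Fr k0; apply: sumr_ge0 => i _.
apply: (le_inf_range _ _ (Ordinal k0)) => j.
by apply: (min_time_ge0 F r) => //; exact: compacts_nonempty.
Qed.

(** Each of the [m] sites contributes the bound of [min_time_lipschitz], applied centre by centre
    under the infimum over [j]. Later uses fix either the centres or the sites. *)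
Lemma f_k_lipschitz {R : realType} {d m k : nat} (F : set 'rV[R]_d) (r s : R)
    (x x' : 'M[R]_(k, d)) (O O' : 'I_m -> compacts R d) :
  convex_set F -> 0 < r -> (forall z, `|z| <= r -> F z) -> (0 < k)%N ->
  (forall i a, compacts_set (O i) a ->
    exists2 b, compacts_set (O' i) b & `|b - a| <= s) ->
  f_k F x' O' <= f_k F x O + m%:R / r * (`|x - x'| + s).
Proof.
move=> cF r0 Fr k0 OO'.
have T0 (Q : 'I_m -> compacts R d) i y : 0 <= min_time F y (Q i).
  by apply: (min_time_ge0 F r) => //; exact: compacts_nonempty.
have -> : m%:R / r * (`|x - x'| + s) = \sum_(i < m) (`|x - x'| + s) / r.
  by rewrite sumr_const card_ord -[in RHS]mulr_natl mulrA mulrAC.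
rewrite -big_split/=; apply: ler_sum => i _.
rewrite -lerBlDr; apply: (le_inf_range _ _ (Ordinal k0)) => j; rewrite lerBlDr.
apply: le_trans (inf_range_le _ j _) _ => //.
apply: le_trans (min_time_lipschitz F r s (row j x) _ (O i) _ cF r0 Fr _ (OO' i)) _.
  exact: compacts_nonempty.
rewrite lerD2l ler_pM2r ?invr_gt0// lerD2r -linearB; exact: row_norm_le.
Qed.

Lemma v_k_lipschitz {R : realType} {d m k : nat} (F : set 'rV[R]_d) (r s : R)
    (O O' : 'I_m -> compacts R d) :
  convex_set F -> 0 < r -> (forall z, `|z| <= r -> F z) -> (0 < k)%N ->
  (forall i a, compacts_set (O i) a ->
    exists2 b, compacts_set (O' i) b & `|b - a| <= s) ->
  v_k k F O' <= v_k k F O + m%:R / r * s.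
Proof.
move=> cF r0 Fr k0 OO'; rewrite -lerBlDr.
apply: (le_inf_range _ _ 0) => x; rewrite lerBlDr.
apply: le_trans (inf_range_le _ x _) _ => [y|]; first exact: (f_k_ge0 F r).
have := f_k_lipschitz F r s x x O O' cF r0 Fr k0 OO'.
by rewrite subrr normr0 add0r.
Qed.

Lemma f_k_continuous {R : realType} {d m k : nat} (F : set 'rV[R]_d) (r : R)
    (O : 'I_m -> compacts R d) :
  convex_set F -> 0 < r -> (forall z, `|z| <= r -> F z) -> (0 < k)%N ->
  continuous (fun x : 'M[R]_(k, d) => f_k F x O).
Proof.
move=> cF r0 Fr k0; apply: (lipschitz_continuous _ (m%:R / r)) => x y.
rewrite -[`|_|]addr0 [`|_|]distrC; apply: (f_k_lipschitz F r) => // i a Oa.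
by exists a => //; rewrite subrr normr0.
Qed.

(** * Existence of a global minimizer *)

(* Sites are only served by nearby centres, so a far centre may be moved to [0]. *)
Lemma f_k_truncate {R : realType} {d m k : nat} (F : set 'rV[R]_d) (r L M : R)
    (O : 'I_m -> compacts R d) (x : 'M[R]_(k, d)) :
  convex_set F -> 0 < r -> (forall z, `|z| <= r -> F z) -> (0 < k)%N ->
  0 <= M -> (forall i y, min_time F y (O i) < L -> `|y| <= M) ->
  f_k F x O < L -> exists2 x' : 'M[R]_(k, d), `|x'| <= M & f_k F x' O <= f_k F x O.
Proof.
move=> cF r0 Fr k0 M0 coer xL.
have T0 i y : 0 <= min_time F y (O i).
  by apply: (min_time_ge0 F r) => //; exact: compacts_nonempty.
pose x' : 'M[R]_(k, d) := \matrix_(j, l) if `|row j x| <= M then x j l else 0.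
have x'near j : `|row j x| <= M -> row j x' = row j x.
  by move=> xM; apply/rowP => l; rewrite !mxE xM.
exists x'.
  apply/mx_norm_le => // j l; rewrite mxE; case: ifPn => [|_]; last by rewrite normr0.
  by apply: le_trans; have := entry_le_mx_norm (row j x) 0 l; rewrite mxE.
apply: ler_sum => i _.
(* The summands are nonnegative, so each is below [L], and site [i] has a centre [j1] that
   truncation leaves in place. *)
have iL : inf (range (fun j => min_time F (row j x) (O i))) < L.
  apply: le_lt_trans xL; rewrite /f_k (bigD1 i)//= lerDl sumr_ge0// => i' _.
  by apply: (le_inf_range _ _ (Ordinal k0)).
have [|_ [j1 _ <-] j1L] := inf_lt _ iL.
  by exists (min_time F (row (Ordinal k0) x) (O i)), (Ordinal k0).
apply: (le_inf_range _ _ (Ordinal k0)) => j.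
have [jL|Lj] := ltP (min_time F (row j x) (O i)) L.
  rewrite -(x'near j (coer _ _ jL)).
  exact: (inf_range_le (fun j => min_time F (row j x') (O i))).
(* A centre [j] with time at least [L] is beaten by [j1]. *)
apply: le_trans (ltW (lt_le_trans j1L Lj)).
rewrite -(x'near j1 (coer _ _ j1L)).
exact: (inf_range_le (fun j => min_time F (row j x') (O i))).
Qed.

Lemma S_k_nonempty {R : realType} {d m k : nat} (F : set 'rV[R]_d) (r : R)
    (O : 'I_m -> compacts R d) :
  compact F -> convex_set F -> 0 < r -> (forall z, `|z| <= r -> F z) ->
  (0 < k)%N -> @S_k R d m k F O !=set0.
Proof.
move=> coF cF r0 Fr k0.
have f0 := fun x => f_k_ge0 F r x O cF r0 Fr k0.
have [MF MF0 FM] := compact_norm_bound F coF.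
have /choice[MO OM] : forall i, exists M : R,
    forall a, compacts_set (O i) a -> `|a| <= M.
  move=> i; have [M _ AM] := compact_norm_bound _ (@compacts_compact _ _ (O i)).
  by exists M.
(* With this [L], any [x] whose value is at least [L] is beaten by the zero configuration; all
   others can be truncated. *)
pose L : R := f_k F (0 : 'M[R]_(k, d)) O + 1.
pose M : R := \big[Num.max/0]_(i < m) MO i + L * MF.
have M0 : 0 < M.
  apply: ltr_wpDl; first exact: bigmax_ge_id.
  by rewrite mulr_gt0// ltr_wpDl.
have coer i y : min_time F y (O i) < L -> `|y| <= M.
  move=> yL; apply: (min_time_coercive F r _ _ _ _ (O i)) yL => //.
    exact: compacts_nonempty.
  by move=> a /OM/le_trans; apply; exact: le_bigmax.
(* Flattening to row vectors makes [bounded_closed_compact] applicable to the ball; neither [vec_mx]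
   nor [mxvec] increases the norm. *)
pose g (v : 'rV[R]_(k * d)) := f_k F (vec_mx v : 'M[R]_(k, d)) O.
have gc : continuous g.
  apply: (lipschitz_continuous _ (m%:R / r)) => v w.
  have mr0 : 0 <= m%:R / r by rewrite divr_ge0// ltW.
  apply: (@le_trans _ _ (g w + m%:R / r * (`|vec_mx w - vec_mx v : 'M[R]_(k, d)| + 0))).
    apply: (f_k_lipschitz F r) => // i a Oa.
    by exists a => //; rewrite subrr normr0.
  by rewrite addr0 lerD2l ler_wpM2l// distrC -linearB vec_mx_norm_le.
have [||c cM cmin] := @compact_EVT_min 'rV[R]_(k * d) R g (closed_ball 0 M) _ _
    (continuous_subspaceT gc).
- by exists 0; apply: closed_ballxx.
- apply: bounded_closed_compact; last exact: closed_ball_closed.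
  exists M; split=> [|N MN v]; first exact: num_real.
  by rewrite closed_ballE// /closed_ball_/= sub0r normrN => /le_trans; apply; exact: ltW.
have {}cmin v : `|v| <= M -> g c <= g v.
  by move=> vM; apply: cmin; rewrite inE closed_ballE// /closed_ball_/= sub0r normrN.
have {cM}minM (x : 'M[R]_(k, d)) : `|x| <= M -> g c <= f_k F x O.
  move=> xM; have := cmin (mxvec x) (le_trans (mxvec_norm_le x) xM).
  by rewrite /g mxvecK.
exists (vec_mx c); apply/le_anti/andP; split; last exact: (inf_range_le (fun x => f_k F x O)).
apply: (le_inf_range _ _ 0) => x.
have [xL|Lx] := ltP (f_k F x O) L.
  have [x' /minM cx' /(le_trans cx')//] :=
    f_k_truncate F r L M O x cF r0 Fr k0 (ltW M0) coer xL.
apply: le_trans (minM 0 _) (le_trans _ Lx); first by rewrite normr0 ltW.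
by rewrite lerDl.
Qed.

Theorem theorem6p4 (R : realType) (d m k : nat)
  (hd : (1 <= d)%N) (hm : (2 <= m)%N) (hk : (1 <= k <= m)%N)
  (F : set 'rV[R]_d)
  (F_compact : compact F) (F_convex : convex_set F) (F_int0 : interior F 0)
  (Ohat : 'I_m -> compacts R d)
  (U0 : set ('I_m -> compacts R d)) (hU0 : hausdorff_nbhs Ohat U0)
  (W : set 'M[R]_(k, d)) (W_compact : compact W)
  (hW : forall O, U0 O -> S_k F O `<=` W) :
  upper_semicontinuous_at (@S_k R d m k F) Ohat.
Proof.
have /andP[k0 _] := hk.
have [r r0 Fr] := interior_norm_ball F F_int0.
split; first exact: (S_k_nonempty F r).
move=> V oV SV; have [e0 e00 eU0] := hU0.
have f0 := fun x => f_k_ge0 F r x Ohat F_convex r0 Fr k0.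
have [eta eta0 gap] : exists2 eta : R, 0 < eta &
    forall x, W x -> ~ V x -> v_k k F Ohat + eta <= f_k F x Ohat.
  (* If [W] minus [V] is empty, any gap will do. Otherwise [eta] is the excess at a minimizer [c],
     positive since [c], being outside [V], is no solution. *)
  have [[x0 [Wx0 Vx0]]|WV0] := pselect ((W `&` ~` V) !=set0); last first.
    by exists 1 => // x Wx Vx; exfalso; apply: WV0; exists x.
  have [||c] := @compact_EVT_min _ R (fun x => f_k F x Ohat) (W `&` ~` V) _ _
      (continuous_subspaceT (f_k_continuous F r Ohat F_convex r0 Fr k0)).
  - by exists x0.
  - by apply: compact_closedI => //; exact: open_closedC.
  rewrite inE => -[Wc Vc] cmin; exists (f_k F c Ohat - v_k k F Ohat).
    rewrite subr_gt0 lt_def inf_range_le// andbT.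
    by apply/eqP => fc; apply: Vc; apply: SV.
  by move=> x Wx Vx; rewrite addrC subrK; apply: cmin; rewrite inE.
pose C : R := m%:R / r.
have C0 : 0 < C by rewrite divr_gt0// ltr0n ltnW.
(* The bound [e0] keeps [O] in [U0], hence its solutions in [W]; the other bound gives
   [C * e <= eta / 4]. *)
pose e := Num.min e0 (eta / (4 * C)).
have e_gt0 : 0 < e by rewrite lt_min e00 divr_gt0// mulr_gt0.
have Ce : 4 * (C * e) <= eta.
  have : e <= eta / (4 * C) by rewrite ge_min lexx orbT.
  by rewrite ler_pdivlMr ?(mulr_gt0 _ C0)// mulrA mulrC.
have Ce0 : 0 < C * e by rewrite mulr_gt0.
exists [set O | hausdorff_dist_tuple Ohat O < e]; first by exists e.
move=> O OhatO x SOx; apply: contrapT => Vx.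
have OOhat : hausdorff_dist_tuple O Ohat < e by rewrite hausdorff_dist_tupleC.
have Wx : W x.
  by apply: hW SOx; apply: eU0; rewrite (lt_le_trans OhatO)// ge_min lexx.
have vle := v_k_lipschitz F r e Ohat O F_convex r0 Fr k0
  (hausdorff_dist_tuple_close _ _ _ OhatO).
(* Together, [f_k F x Ohat <= v_k k F O + C * e <= v_k k F Ohat + 2 * C * e], which is below
   [v_k k F Ohat + eta]. *)
have := f_k_lipschitz F r e x x O Ohat F_convex r0 Fr k0
  (hausdorff_dist_tuple_close _ _ _ OOhat).
rewrite subrr normr0 add0r SOx -/C => fle.
have := gap x Wx Vx; rewrite -/C in vle; lra.
Qed.
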